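(* Let $a,b\geq 3$ be integers with $(a,b)\neq(4,3)$ and $(a,b)\neq(3,4)$, let $d=a+b+1$, and let $p$ be the least prime with $p\geq d$. Then the LPModSum protocol, in which Alice publicly announces $\sum_p A$ and Bob publicly announces $\sum_p B$, is secure for card deals of size $(a,b,1)$.
   Context: Cards are the integers $0,\dots,d-1$, $D=\{0,\dots,d-1\}$. A deal of size $(a,b,c)$ is a triple $(A,B,C)$ of pairwise disjoint subsets of $D$ of sizes $a,b,c$ held by Alice, Bob and Cath respectively; initially each player knows only her own hand. For $X\subseteq D$, $\sum_p X$ is the sum of the elements of $X$ in $\mathbb Z/(p)$. Announcements are truthful and public, and restrict the possible deals to those consistent with them. Secure means: for every deal $(A,B,C)$ and every card $z\notin C$, after the announcements Cath (knowing $C$) does not know whether $z$ is held by Alice or by Bob, i.e. there exist deals $(A',B',C)$ and $(A'',B'',C)$ of the same size, consistent with the announced values $\sum_pA$ and $\sum_pB$, with $z\notin A'$ and $z\notin B''$. *)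

(* Defs.v *)
From mathcomp Require Import all_boot all_order all_algebra.

Set Implicit Arguments.
Unset Strict Implicit.
Unset Printing Implicit Defensive.

Definition is_deal (d a b c : nat) (A B C : {set 'I_d}) : Prop :=
  [/\ [disjoint A & B], [disjoint A & C] & [disjoint B & C]] /\
  [/\ #|A| = a, #|B| = b & #|C| = c].

(* 'Z_p is Z/(p) only for 1 < p; below p is always a prime. *)
Definition modsum (p d : nat) (X : {set 'I_d}) : 'Z_p :=
  (\sum_(x in X) (x : nat)%:R)%R.

(* Alice announces annA A and Bob announces annB B. The deals that Cath cannot
   rule out are those with the same sizes, her own hand C, and the same two
   announced values. *)
Definition cath_considers (T : Type) (d a b c : nat)
    (annA annB : {set 'I_d} -> T) (A B C A' B' : {set 'I_d}) : Prop :=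
  [/\ is_deal a b c A' B' C, annA A' = annA A & annB B' = annB B].

Definition secure (T : Type) (d a b c : nat)
    (annA annB : {set 'I_d} -> T) : Prop :=
  forall A B C : {set 'I_d}, is_deal a b c A B C ->
  forall z : 'I_d, z \notin C ->
    (exists A' B' : {set 'I_d},
       cath_considers a b c annA annB A B C A' B' /\ z \notin A') /\
    (exists A'' B'' : {set 'I_d},
       cath_considers a b c annA annB A B C A'' B'' /\ z \notin B'').

Definition is_least_prime_geq (d p : nat) : Prop :=
  [/\ prime p, d <= p & forall q : nat, prime q -> d <= q -> p <= q].

Definition LPModSum_secure (d a b c p : nat) : Prop :=
  secure a b c (@modsum p d) (@modsum p d).

(* Main.v *)
Require Import Defs.
From mathcomp Require Import all_boot all_order all_algebra.
From mathcomp Require Import perm finfield.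
From mathcomp Require Import zify.

(** Fix Cath's card and a card [z] held by Alice or Bob. Bob's sum is determined
    by Alice's, so it suffices to find, in the remaining [a + b - 1] cards, a set
    of [a] cards (resp. [b] cards) avoiding [z] with a prescribed sum mod [p].

    By the Dias da Silva-Hamidoune theorem, the [m]-subsets of an [N]-subset of
    Z/p reach every residue as soon as [p - 1 <= m (N - m)]. This is the
    polynomial method of Alon, Nathanson and Ruzsa: if [r] is not reached,
    [V(x) ((x_1 + ... + x_m - r)^(p-1) - 1)], with [V] the Vandermonde product,
    vanishes on [X^m], although its coefficient at a suitable monomial [x^c] with
    distinct exponents [c_i < N] is, up to the factor [c_1! ... c_m!],
    [(p-1)! \prod_(i<j) (c_j - c_i)], which is nonzero mod [p].

    Here [m (N - m)] is [a (b - 1)] or [b (a - 1)], both at least [2d - 8], so one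
    needs a prime in [[d, 2d - 7]]. Erdos' proof of Bertrand's postulate shows
    that for large [n] there is a prime in [(n, 2n]] distinct from any given one;
    take [n = d - 3] and exclude the only possible prime among [d - 2], [d - 1]. *)

Set Implicit Arguments.
Unset Strict Implicit.
Unset Printing Implicit Defensive.

Import GRing.Theory.

(** * Prime powers dividing the central binomial coefficient *)

Lemma prime_ndvd_fact p k : prime p -> k < p -> ~~ (p %| k`!).
Proof.
move=> pr_p; elim: k => [|k IHk] ltkp.
  by rewrite dvdn1 gtn_eqF ?prime_gt1.
rewrite factS Euclid_dvdM // negb_or IHk ?(ltnW ltkp) // andbT.
by apply/negP => /dvdn_leq; lia.
Qed.

(** Legendre's formula applied to [(2n)! = C(2n, n) n! n!]. The terms with [n < k <= 2n] added to
    the sum for [n!] are zero, and the truncated subtraction is exact. *)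
Lemma logn_bin_double p n : prime p ->
  logn p 'C(n.*2, n) =
    \sum_(1 <= k < n.*2.+1) (n.*2 %/ p ^ k - (n %/ p ^ k).*2).
Proof.
move=> pr_p.
have le_n : n <= n.*2 by lia.
have Cgt0 : 0 < 'C(n.*2, n) by rewrite bin_gt0.
have /(congr1 (logn p)) := bin_fact le_n.
have -> : n.*2 - n = n by lia.
rewrite !lognM ?muln_gt0 ?fact_gt0 // !logn_fact // addnn.
have -> : \sum_(1 <= k < n.+1) n %/ p ^ k = \sum_(1 <= k < n.*2.+1) n %/ p ^ k.
  rewrite [RHS](@big_cat_nat _ _ _ n.+1) //=.
  rewrite [X in _ = _ + X]big_nat_cond [X in _ = _ + X]big1 ?addn0 // => k.
  rewrite andbT => /andP[ltnk _]; rewrite divn_small //.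
  by apply: (leq_trans ltnk); exact/ltnW/ltn_expl/prime_gt1.
move=> E; apply/eqP.
rewrite -(eqn_add2r (\sum_(1 <= k < n.*2.+1) n %/ p ^ k).*2).
rewrite E -[(\sum_(_ <= _ < _) _).*2]muln2 big_distrl -big_split /=.
apply/eqP; apply: eq_bigr => k _; rewrite -!muln2 subnK //.
by rewrite leq_divRL ?expn_gt0 ?prime_gt0 // mulnAC leq_mul2r leq_divM orbT.
Qed.

Lemma divn_double_sub_le1 n d : n.*2 %/ d - (n %/ d).*2 <= 1.
Proof.
case: d => [|d]; first by rewrite !divn0.
have := divn_eq n d.+1; have := ltn_pmod n (ltn0Sn d).
have := divn_eq n.*2 d.+1; have := ltn_pmod n.*2 (ltn0Sn d).
set q := n %/ _; set q2 := n.*2 %/ _; nia.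
Qed.

(** Each term of Legendre's sum is at most 1, and the terms beyond the [k]-th vanish. *)
Lemma logn_bin_double_le p n k : prime p -> n.*2 < p ^ k.+1 ->
  logn p 'C(n.*2, n) <= k.
Proof.
move=> pr_p lt2n; rewrite logn_bin_double //.
have sum_le j :
    \sum_(1 <= i < j.+1) (n.*2 %/ p ^ i - (n %/ p ^ i).*2) <= j.
  apply: (@leq_trans (\sum_(1 <= i < j.+1) 1)).
    by apply: leq_sum => i _; apply: divn_double_sub_le1.
  by rewrite sum_nat_const_nat; lia.
have [ltk|lek] := ltnP k n.*2; last exact: leq_trans lek.
rewrite (@big_cat_nat _ _ _ k.+1) //=; last by lia.
rewrite [X in _ + X]big_nat_cond [X in _ + X]big1 ?addn0 // => i.
rewrite andbT => /andP[lei _]; rewrite divn_small //.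
by apply: (leq_trans lt2n); rewrite leq_exp2l ?prime_gt1.
Qed.

Lemma expn_logn_bin_double_le p n : prime p -> 0 < n ->
  p ^ logn p 'C(n.*2, n) <= n.*2.
Proof.
move=> pr_p n_gt0; have p_gt1 := prime_gt1 pr_p.
apply: leq_trans (@trunc_logP p n.*2 _ _); rewrite ?double_gt0 //.
by rewrite leq_exp2l //; apply: logn_bin_double_le; rewrite ?trunc_log_ltn.
Qed.

(** The first term is at most [2 - 2 * 1 = 0]; the others vanish because [p ^ 2 >= 3 * p > 2n]. *)
Lemma logn_bin_double_eq0 p n : prime p -> 2 < p -> n.*2 < 3 * p -> p <= n ->
  logn p 'C(n.*2, n) = 0.
Proof.
move=> pr_p p_gt2 lt2n lepn; rewrite logn_bin_double //.
rewrite big_nat_cond big1 // => -[|[|k]] //; rewrite andbT => _.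
  rewrite expn1; apply/eqP; rewrite subn_eq0 leqNgt.
  apply/negP => lt; have n1 : 1 <= n %/ p by rewrite divn_gt0 //; lia.
  have n3 : 3 <= n.*2 %/ p by lia.
  by rewrite leq_divRL in n3; lia.
rewrite divn_small //; apply: (leq_trans lt2n).
rewrite !expnS mulnA -[X in X <= _]muln1 leq_mul ?expn_gt0 ?prime_gt0 //.
by rewrite leq_mul2r; lia.
Qed.

(** * Bounds for binomial coefficients and for products of primes *)

Lemma bin_double_ge n : 0 < n -> 4 ^ n <= n.*2 * 'C(n.*2, n).
Proof.
elim: n => [//|[|n] IHn _]; first by [].
have {}IHn := IHn isT.
set N := n.+1 in IHn *.
have E : N.+1 * 'C(N.+1.*2, N.+1) = 2 * (N.*2.+1 * 'C(N.*2, N)).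
  rewrite doubleS mul_bin_diag /=.
  have := mul_bin_left N.*2.+1 N; have -> : N.*2.+1 - N = N.+1 by lia.
  have := mul_bin_diag N.*2 N; rewrite /= => E1 E2.
  have := binS N.*2.+1 N; nia.
by rewrite expnS; nia.
Qed.

(** The two equal middle terms of [(1 + 1) ^ (2n + 1)] add up to at most [2 * 4 ^ n]. *)
Lemma bin_odd_le n : 'C(n.*2.+1, n) <= 4 ^ n.
Proof.
have := expnDn 1 1 n.*2.+1.
rewrite addn1 expnS -{1}mul2n expnM => E.
have le1 : n < n.*2.+2 by lia.
have le2 : n.+1 < n.*2.+2 by lia.
have neq : Ordinal le2 != Ordinal le1 by rewrite -val_eqE /=; lia.
move: E; rewrite (bigD1 (Ordinal le1)) //= (bigD1 (Ordinal le2)) //=.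
rewrite !exp1n !muln1 -(@bin_sub n.*2.+1 n.+1); last by lia.
have -> : n.*2.+1 - n.+1 = n by lia.
by rewrite -/(4 ^ n); move: (4 ^ n); lia.
Qed.

Definition primorial n := \prod_(0 <= p < n.+1 | prime p) p.

Lemma dvdn_prod_primes (s : seq nat) N : uniq s -> all prime s ->
  (forall p : nat, p \in s -> p %| N) -> \prod_(p <- s) p %| N.
Proof.
elim: s => [|p s IHs] /=; first by rewrite big_nil dvd1n.
move=> /andP[ps us] /andP[pr_p pr_s] dvdN; rewrite big_cons Gauss_dvd.
  rewrite dvdN ?mem_head // IHs // => q qs.
  by apply: dvdN; rewrite inE qs orbT.
elim: s ps us pr_s {dvdN IHs} => [|q s IHs]; first by rewrite big_nil coprimen1.
rewrite inE negb_or => /andP[neq ps] /= /andP[_ us] /andP[pr_q pr_s].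
by rewrite big_cons coprimeMr IHs // andbT prime_coprime // dvdn_prime2.
Qed.

(** An even [N > 2] contributes no prime. For [N = 2m + 1], the primes in [(m + 1, N]] all divide
    [C(N, m)], which is at most [4 ^ m]. *)
Lemma primorial_le n : primorial n <= 4 ^ n.
Proof.
elim/ltn_ind: n => -[|[|[|n]]] IHn; try by rewrite /primorial unlock.
set N := n.+3.
have [odd_N|even_N] := boolP (odd N); last first.
  rewrite /primorial big_mkcond big_nat_recr //= -big_mkcond /=.
  rewrite ifN; last by apply/negP => /even_prime; lia.
  rewrite muln1; apply: leq_trans (IHn n.+2 _) _ => //.
  by rewrite leq_exp2l.
have [m defN] : exists m, N = m.*2.+1 by exists N./2; lia.
have /(IHn _) IHm : m.+1 < N by lia.
rewrite /primorial (@big_cat_nat _ _ _ m.+2) //=; last by lia.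
have -> : 4 ^ N = 4 ^ m.+1 * 4 ^ m by rewrite -expnD; congr (_ ^ _); lia.
apply: leq_mul => //; apply: leq_trans (bin_odd_le m).
apply: dvdn_leq; first by rewrite bin_gt0; lia.
rewrite -big_filter; apply: dvdn_prod_primes.
- by rewrite filter_uniq ?iota_uniq.
- exact: filter_all.
move=> p; rewrite mem_filter mem_index_iota => /and3P[pr_p ltmp lepN].
have : p %| (m.*2.+1)`! by rewrite dvdn_fact // prime_gt0 //; lia.
rewrite -(@bin_fact m.*2.+1 m); last by lia.
have ndvd1 : (p %| m`!) = false by apply/negbTE/prime_ndvd_fact; lia.
have ndvd2 : (p %| (m.*2.+1 - m)`!) = false.
  by apply/negbTE/prime_ndvd_fact; lia.
by rewrite !Euclid_dvdM // ndvd1 ndvd2 !orbF.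
Qed.

(** * Erdos' argument for primes in an interval *)

Lemma expn6_le_expn2 t : 36 <= t -> t ^ 6 <= 2 ^ (t - 3).
Proof.
move=> le36; rewrite -(subnKC le36); elim: (t - 36) => [|u IHu].
  (* The base case is [36 ^ 2 <= 2 ^ 11] cubed, which keeps the computed numbers small. *)
  have cube x k : x ^ 2 <= 2 ^ k -> x ^ (2 * 3) <= 2 ^ (k * 3).
    by rewrite !expnM leq_exp2r.
  by rewrite addn0; apply: (cube 36 11).
have -> : 36 + u.+1 - 3 = (36 + u - 3).+1 by lia.
rewrite [2 ^ _.+1]expnS; apply: leq_trans (leq_mul (leqnn 2) IHu).
(* The ratio satisfies [(y / x) ^ 2 <= (10 / 9) ^ 2 <= 5 / 4], and [(5 / 4) ^ 3 < 2]. *)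
have {IHu} : 9 * (36 + u.+1) <= 10 * (36 + u) by lia.
move: (36 + u) (36 + u.+1) => x y le.
have {}le : 4 * y ^ 2 <= 5 * x ^ 2.
  have : (9 * y) ^ 2 <= (10 * x) ^ 2 by rewrite leq_exp2r.
  by rewrite !expnMn; lia.
have : (4 * y ^ 2) ^ 3 <= (5 * x ^ 2) ^ 3 by rewrite leq_exp2r.
by rewrite (expnMn 4) (expnMn 5) -!expnM; lia.
Qed.

(** Allowing for [q0] costs only one extra factor [2n] in the upper bound for [C(2n, n)]. The bound
    on [n] ensures [35 <= s], so that [expn6_le_expn2] applies to [s.+1]. *)
Lemma exists_prime_neq_between n (q0 : nat) : 630 <= n ->
  exists q, [/\ prime q, n < q, q <= n.*2 & q != q0].
Proof.
move=> n_ge.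
have [/hasP[q]|/hasPn noq] := boolP
    (has [pred q | prime q && (q != q0)] (index_iota n.+1 n.*2.+1)).
  rewrite mem_index_iota /= => /andP[lt1 lt2] /andP[pr_q neq].
  by exists q; split.
exfalso.
have n_gt0 : 0 < n by lia.
pose P s := s ^ 2 <= n.*2.
have exP : exists s, P s by exists 0.
have ubP s : P s -> s <= n.*2 by rewrite /P; nia.
have [s sP smax] := ex_maxnP exP ubP.
have {smax} lt_sq : n.*2 < s.+1 ^ 2.
  by rewrite ltnNge; apply/negP => /smax; rewrite ltnn.
have s_le := ubP _ sP; rewrite /P in sP.
have s_ge : 35 <= s by nia.
set m := n.*2 %/ 3.
(* Prime powers dividing the central binomial: at most [2n] for [p <= s], at most
   [p] for [s < p <= 2n/3], none for [2n/3 < p <= n], and only [q0] beyond [n]. *)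
pose f p := (if p \in index_iota 1 s.+1 then n.*2 else 1).
pose g p := (if prime p && (p <= m) then p else 1).
pose h p := (if p == q0 then n.*2 else 1).
have Cgt0 : 0 < 'C(n.*2, n) by rewrite bin_gt0; lia.
have Cle : 'C(n.*2, n) <= \prod_(0 <= p < n.*2.+1) (f p * (g p * h p)).
  rewrite -{1}(partnT Cgt0) (@widen_partn (n.*2 + 'C(n.*2, n))) ?leq_addl //.
  rewrite (@big_cat_nat _ _ _ n.*2.+1) //=; last by lia.
  rewrite [X in _ * X]big_nat_cond [X in _ * X]big1 ?muln1 => [|p].
    apply: leq_prod => p _.
    have [pr_p|npr_p] := boolP (prime p); last first.
      rewrite lognE (negPf npr_p) expn0 !muln_gt0 /f /g /h.
      by rewrite (negPf npr_p) /=; do 2?[case: ifP => _]; lia.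
    have p_gt1 := prime_gt1 pr_p.
    have [les|lts] := leqP p s.
      apply: leq_trans (expn_logn_bin_double_le pr_p n_gt0) _.
      rewrite /f mem_index_iota ltnS les prime_gt0 // leq_pmulr //.
      by rewrite muln_gt0 /g /h; do 2?[case: ifP => _]; lia.
    have le1 : logn p 'C(n.*2, n) <= 1.
      apply: logn_bin_double_le => //; apply: (leq_trans lt_sq).
      by rewrite leq_exp2r.
    rewrite {1}/f mem_index_iota ltnS [p <= s]leqNgt lts andbF mul1n.
    have [lem|ltm] := leqP p m.
      rewrite /g pr_p lem /=; apply: (@leq_trans (p ^ 1)).
        by rewrite leq_exp2l.
      by rewrite expn1 leq_pmulr // /h; case: ifP => _; lia.
    have [len|ltn] := leqP p n.
      rewrite logn_bin_double_eq0 ?expn0 //; try by rewrite /m in ltm; lia.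
      by rewrite muln_gt0 /g /h; do 2?[case: ifP => _]; lia.
    have [le2n|lt2n] := leqP p n.*2; last first.
      have /(logn_bin_double_le pr_p) : n.*2 < p ^ 1 by rewrite expn1.
      rewrite leqn0 => /eqP ->.
      by rewrite muln_gt0 /g /h; do 2?[case: ifP => _]; lia.
    have := noq p; rewrite mem_index_iota ltn ltnS le2n /= pr_p negbK.
    move=> /(_ isT) eq_q0; rewrite /h eq_q0 /g [p <= m]leqNgt ltm andbF mul1n.
    apply: leq_trans le2n.
    by rewrite -[X in _ <= X]expn1 leq_exp2l.
  rewrite andbT => /andP[lt2n _].
  have [pr_p|npr_p] := boolP (prime p); last by rewrite lognE (negPf npr_p).
  have /(logn_bin_double_le pr_p) : n.*2 < p ^ 1 by rewrite expn1.
  by rewrite leqn0 => /eqP ->.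
have {}Cle : 'C(n.*2, n) <= n.*2 ^ s * (4 ^ m * n.*2).
  apply: (leq_trans Cle); rewrite !big_split /=; apply: leq_mul.
    rewrite /f (@big_cat_nat _ _ _ s.+1) //= big_ltn // {1}mem_index_iota mul1n.
    rewrite [X in _ * X]big_nat_cond [X in _ * X]big1 ?muln1 => [|p].
      rewrite (eq_big_nat _ _ (F2 := fun=> n.*2)) => [|p].
        by rewrite prod_nat_const_nat subSS subn0.
      by rewrite mem_index_iota => ->.
    by rewrite andbT mem_index_iota => /andP[lts _];
      rewrite ltnS [p <= s]leqNgt lts andbF.
  apply: leq_mul.
    apply: leq_trans (primorial_le m).
    rewrite /g /primorial (@big_cat_nat _ _ _ m.+1) //=;
      last by rewrite /m; lia.
    rewrite [X in _ * X]big_nat_cond [X in _ * X]big1 ?muln1 => [|p].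
      rewrite [X in _ <= X]big_mkcond /= big_nat [X in _ <= X]big_nat.
      by apply: leq_prod => p; rewrite ltnS => /= ->; rewrite andbT.
    by rewrite andbT => /andP[ltm _]; rewrite leqNgt ltm andbF.
  rewrite /h -big_mkcond /= -big_filter.
  set l := [seq _ <- _ | _].
  have : all (pred1 q0) l by apply: filter_all.
  have : uniq l by rewrite filter_uniq ?iota_uniq.
  case: l => [|x [|y l]] /=; rewrite ?big_nil ?big_seq1; try by lia.
  move=> /andP[nin _] /and3P[/eqP defx /eqP defy _].
  by rewrite defx defy mem_head in nin.
have : 4 ^ n <= n.*2 ^ s.+2 * 4 ^ m.
  apply: leq_trans (bin_double_ge n_gt0) _.
  apply: leq_trans (leq_mul (leqnn _) Cle) _.
  by rewrite expnS expnSr -!mulnA [4 ^ m * _]mulnC.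
(* Cubing absorbs [4 ^ m] into [4 ^ (2n)]. What remains contradicts [(2n) ^ (3 (s + 2)) <= (s + 1) ^
   (6 (s + 2)) <= 2 ^ ((s - 2) (s + 2)) < 2 ^ (2n)], the last because [s ^ 2 <= 2n]. *)
rewrite -(@leq_exp2r _ _ 3) //.
apply/negP; rewrite -ltnNge expnMn -!expnM.
have m3 : m * 3 <= n.*2 by rewrite leq_divM.
apply: (@leq_ltn_trans (s.+1 ^ (6 * s.+2) * 4 ^ n.*2)).
  apply: leq_mul; last by rewrite leq_exp2l.
  have -> : 6 * s.+2 = 2 * (s.+2 * 3) by lia.
  by rewrite [X in _ <= X]expnM leq_exp2r //; apply: ltnW.
have -> : n * 3 = n + n.*2 by lia.
rewrite expnD ltn_mul2r expn_gt0 /=.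
have s1_ge : 36 <= s.+1 by lia.
apply: (@leq_ltn_trans ((2 ^ (s.+1 - 3)) ^ s.+2)).
  by rewrite expnM leq_exp2r // expn6_le_expn2.
rewrite -expnM (_ : 4 = 2 ^ 2) // -expnM ltn_exp2l //.
by rewrite mul2n; nia.
Qed.

Lemma exists_prime_between d : 9 <= d ->
  exists q, [/\ prime q, d <= q & q + 7 <= d.*2].
Proof.
move=> d_ge; have [lt_d|ge_d] := ltnP d 640.
  have wit q : prime q -> (d <= q) && (q + 7 <= d.*2) ->
      exists q, [/\ prime q, d <= q & q + 7 <= d.*2].
    by move=> pr_q /andP[]; exists q.
  (* Each prime of the chain is [2 q - 5] for its predecessor [q], the largest value allowed at
     [d = q + 1]. *)
  have [?|?] := leqP d 11; first by apply: (wit 11); [vm_compute|lia].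
  have [?|?] := leqP d 17; first by apply: (wit 17); [vm_compute|lia].
  have [?|?] := leqP d 29; first by apply: (wit 29); [vm_compute|lia].
  have [?|?] := leqP d 53; first by apply: (wit 53); [vm_compute|lia].
  have [?|?] := leqP d 101; first by apply: (wit 101); [vm_compute|lia].
  have [?|?] := leqP d 197; first by apply: (wit 197); [vm_compute|lia].
  have [?|?] := leqP d 389; first by apply: (wit 389); [vm_compute|lia].
  by apply: (wit 773); [vm_compute|lia].
(* Only the odd one of [d - 2] and [d - 1] can be prime. The bound [q <= 2d - 6] improves to
   [2d - 7] because [q] is odd. *)
pose q0 := if prime d.-2 then d.-2 else d.-1.
have [|q [pr_q ltq leq neq]] := @exists_prime_neq_between (d - 3) q0.
  by lia.
have q_odd : odd q by have /even_prime[|] := pr_q; lia.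
exists q; split; [by []| |by lia].
rewrite leqNgt; apply/negP => ltd.
have : (q == d.-2) || (q == d.-1) by lia.
move: neq; rewrite /q0; case: ifP => [pr|npr] neq /orP[]/eqP defq.
- by move: neq; rewrite defq eqxx.
- have /even_prime[|] := pr; lia.
- by rewrite defq npr in pr_q.
- by move: neq; rewrite defq eqxx.
Qed.

(** * Sums of subsets of a prime field, by the polynomial method *)

Section RestrictedSums.

Local Open Scope ring_scope.

Lemma ffact_horner (R : comNzRingType) (c j : nat) :
  (\prod_(l < j) ('X - (l : nat)%:R%:P)).[c%:R] = (c ^_ j)%:R :> R.
Proof.
elim: j => [|j IHj]; first by rewrite big_ord0 hornerC ffactn0.
rewrite big_ord_recr /= hornerM IHj hornerXsubC ffactnSr natrM.
have [lejc|ltcj] := leqP j c; first by rewrite natrB.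
by rewrite ffact_small // !mul0r.
Qed.

(** The falling factorial of order [j] is a monic polynomial of degree [j], so the matrix is a
    Vandermonde matrix up to a unitriangular factor. *)
Lemma det_ffact (R : comNzRingType) m (c : 'I_m -> nat) :
  \det (\matrix_(i < m, j < m) (c i ^_ j)%:R) =
  \prod_(i < m) \prod_(j < m | (i < j)%N) ((c j)%:R - (c i)%:R) :> R.
Proof.
pose Q j : {poly R} := \prod_(l < j) ('X - (l : nat)%:R%:P).
have szQ j : size (Q j) = j.+1.
  by rewrite size_prod_XsubC -[index_enum _]enumT size_enum_ord.
pose a : 'rV[R]_m := \row_j (c j)%:R.
pose T : 'M[R]_m := \matrix_(j, k) (Q j)`_k.
have -> : \matrix_(i < m, j < m) (c i ^_ j)%:R = (T *m Vandermonde m a)^T.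
  apply/matrixP => i j; rewrite !mxE -ffact_horner -/(Q j).
  rewrite (@horner_coef_wide _ m) ?szQ //; apply: eq_bigr => k _.
  by rewrite !mxE.
rewrite det_tr det_mulmx det_Vandermonde det_trig; last first.
  apply/is_trig_mxP => j k ltjk; rewrite mxE nth_default // szQ.
  exact: ltjk.
rewrite big1 ?mul1r => [|j _]; last first.
  have /monicP := monic_prod_XsubC (index_enum 'I_j) predT
    (fun l => (l : nat)%:R : R).
  by rewrite mxE lead_coefE -/(Q j) szQ.
by apply: eq_bigr => i _; apply: eq_bigr => j _; rewrite !mxE.
Qed.

Section DualWeights.

Variables (F : fieldType) (m N : nat) (e : 'I_N -> F) (c : 'I_m -> nat).
Variable w : 'I_m -> 'I_N -> F.
Hypothesis c_lt : forall i, (c i < N)%N.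
Hypothesis w_dual : forall i (t : nat), (t < N)%N ->
  \sum_j w i j * e j ^+ t = (t == c i)%:R.

(* On polynomials of total degree at most [\sum_i c i], [dual_eval] reads off the
   coefficient of [x^c]: every other monomial has some exponent below [c i],
   which the weights [w i] kill. *)
Definition dual_eval (f : {ffun 'I_m -> 'I_N} -> F) : F :=
  \sum_(phi : {ffun 'I_m -> 'I_N}) (\prod_i w i (phi i)) * f phi.

Lemma dual_eval_sum (K : finType) (a : K -> F)
    (f : K -> {ffun 'I_m -> 'I_N} -> F) :
  dual_eval (fun phi => \sum_k a k * f k phi) =
  \sum_k a k * dual_eval (f k).
Proof.
rewrite /dual_eval; under eq_bigr do rewrite mulr_sumr.
rewrite exchange_big; apply: eq_bigr => k _; rewrite mulr_sumr.
by apply: eq_bigr => phi _; rewrite mulrCA.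
Qed.

Definition monom_at (n : {ffun 'I_m -> nat}) (phi : {ffun 'I_m -> 'I_N}) : F :=
  \prod_i e (phi i) ^+ n i.

Definition sum_at (phi : {ffun 'I_m -> 'I_N}) : F := \sum_i e (phi i).

Lemma dual_eval_monom n :
  dual_eval (monom_at n) = \prod_i \sum_j w i j * e j ^+ n i.
Proof.
rewrite bigA_distr_bigA; apply: eq_bigr => phi _.
by rewrite /monom_at -big_split.
Qed.

Definition incr_expt (n : {ffun 'I_m -> nat}) (i : 'I_m) : {ffun 'I_m -> nat} :=
  [ffun j => (n j + (j == i))%N].

Lemma sum_incr_expt n i : (\sum_j incr_expt n i j = (\sum_j n j).+1)%N.
Proof.
under eq_bigr do rewrite ffunE.
by rewrite big_split /= -big_mkcond /= big_pred1_eq addn1.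
Qed.

(** Peeling off one factor of the power permits induction on [q] without multinomial
    coefficients. *)
Lemma dual_eval_expS n q :
  dual_eval (fun phi => monom_at n phi * sum_at phi ^+ q.+1) =
  \sum_i dual_eval (fun phi => monom_at (incr_expt n i) phi * sum_at phi ^+ q).
Proof.
rewrite exchange_big /=; apply: eq_bigr => phi _.
rewrite -mulr_sumr; congr (_ * _); rewrite exprS {1}/sum_at mulr_suml mulr_sumr.
apply: eq_bigr => i _; rewrite mulrA; congr (_ * _).
rewrite /monom_at; under [RHS]eq_bigr do rewrite ffunE exprD.
rewrite big_split /=; congr (_ * _).
rewrite [RHS](bigD1 i) //= eqxx expr1 big1 ?mulr1 // => j /negPf ->.
by rewrite expr0.
Qed.

Lemma dual_eval_small (n : {ffun 'I_m -> nat}) q :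
  (\sum_i n i + q < \sum_i c i)%N ->
  dual_eval (fun phi => monom_at n phi * sum_at phi ^+ q) = 0.
Proof.
elim: q n => [|q IHq] n lt_c; last first.
  by rewrite dual_eval_expS big1 // => i _; rewrite IHq // sum_incr_expt; lia.
have -> : dual_eval (fun phi => monom_at n phi * sum_at phi ^+ 0) =
      dual_eval (monom_at n).
  by apply: eq_bigr => phi _; rewrite mulr1.
have /existsP[i lti] : [exists i, (n i < c i)%N].
  apply: contraLR lt_c => /existsPn nlt.
  by rewrite -leqNgt addn0; apply: leq_sum => i _; rewrite leqNgt nlt.
rewrite dual_eval_monom (bigD1 i) //= w_dual; last exact: ltn_trans (c_lt i).
by rewrite (ltn_eqF lti) mul0r.
Qed.

(** The coefficient of [x^c] in [x^n (x_1 + ... + x_m)^q] is [q! / \prod_i (c_i - n_i)!];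
    multiplying by the [c_i!] avoids division in [F]. *)
Lemma dual_eval_top (n : {ffun 'I_m -> nat}) q :
  (\sum_i n i + q = \sum_i c i)%N ->
  (\prod_i (c i)`!)%:R *
    dual_eval (fun phi => monom_at n phi * sum_at phi ^+ q) =
  (q`! * \prod_i (c i ^_ n i))%:R.
Proof.
elim: q n => [|q IHq] n def_q.
  have -> : dual_eval (fun phi => monom_at n phi * sum_at phi ^+ 0) =
      dual_eval (monom_at n).
    by apply: eq_bigr => phi _; rewrite mulr1.
  rewrite dual_eval_monom fact0 mul1n.
  have [/existsP[i lti]|/existsPn nlt] := boolP [exists i, (n i < c i)%N].
    rewrite [X in _ * X](bigD1 i) //= w_dual; last exact: ltn_trans (c_lt i).
    rewrite (ltn_eqF lti) mul0r mulr0.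
    have /existsP[j ltj] : [exists j, (c j < n j)%N].
      apply/existsPn => /= nlt.
      have : (\sum_i n i < \sum_i c i)%N.
        rewrite (bigD1 i) //= [X in (_ < X)%N](bigD1 i) //= -addSn leq_add //.
        by apply: leq_sum => j _; rewrite leqNgt nlt.
      by lia.
    by rewrite (bigD1 j) //= ffact_small.
  have n_eq i : n i = c i.
    apply/eqP; rewrite eqn_leq [(c i <= _)%N]leqNgt nlt andbT leqNgt.
    apply/negP => lti.
    have : (\sum_i c i < \sum_i n i)%N.
      rewrite (bigD1 i) //= [X in (_ < X)%N](bigD1 i) //= -addSn leq_add //.
      by apply: leq_sum => j _; rewrite leqNgt nlt.
    by lia.
  rewrite [X in _ * X]big1 ?mulr1 => [|i _]; last by rewrite n_eq w_dual ?eqxx.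
  by congr _%:R; apply: eq_bigr => i _; rewrite n_eq ffactnn.
rewrite dual_eval_expS mulr_sumr.
have rec i : (\prod_i (c i)`!)%:R *
    dual_eval (fun phi => monom_at (incr_expt n i) phi * sum_at phi ^+ q) =
    (q`! * (\prod_j (c j ^_ n j) * (c i - n i)))%:R.
  rewrite IHq ?sum_incr_expt; last by lia.
  congr (_ * _)%:R; rewrite (bigD1 i) //= [in RHS](bigD1 i) //=.
  rewrite ffunE eqxx addn1 ffactnSr mulnAC; congr (_ * _ * _)%N.
  by apply: eq_bigr => j /negPf ne_ji; rewrite ffunE ne_ji addn0.
rewrite (eq_bigr _ (fun i _ => rec i)) -natr_sum -!big_distrr /=.
(* If some [c j < n j], the truncated differences no longer sum to [q.+1], but a zero falling
   factorial kills both sides. *)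
have [/existsP[j ltj]|/existsPn nlt] := boolP [exists j, (c j < n j)%N].
  by rewrite (bigD1 j) //= ffact_small // !mul0n !muln0.
have -> : (\sum_i (c i - n i) = q.+1)%N.
  have : (\sum_i (c i - n i) + \sum_i n i = \sum_i c i)%N.
    rewrite -big_split /=; apply: eq_bigr => i _.
    by rewrite subnK // leqNgt nlt.
  by lia.
by rewrite factS [in LHS]mulnC -[in LHS]mulnA [in LHS]mulnC.
Qed.

End DualWeights.

(** Distinct nodes make the Vandermonde matrix invertible; the columns of its inverse are the
    weights. *)
Lemma dual_weights (F : fieldType) N (e : 'I_N -> F) : injective e ->
  exists w : 'I_N -> 'I_N -> F, forall k (t : nat), (t < N)%N ->
    \sum_j w k j * e j ^+ t = (t == k)%:R.
Proof.
move=> e_inj; pose V := Vandermonde N (\row_j e j).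
have unitV : V \in unitmx.
  rewrite unitmxE det_Vandermonde unitfE; apply/prodf_neq0 => i _.
  apply/prodf_neq0 => j ltij; rewrite !mxE subr_eq0 (inj_eq e_inj).
  by rewrite -val_eqE /= gtn_eqF.
exists (fun k j => invmx V j k) => k t lt_t.
have := mulmxV unitV => /matrixP/(_ (Ordinal lt_t) k); rewrite !mxE => <-.
by apply: eq_bigr => j _; rewrite !mxE mulrC.
Qed.

Lemma sum_ord_geq m t : (\sum_(i < m) (t <= i) = m - t)%N.
Proof.
elim: m => [|m IHm]; first by rewrite big_ord0.
by rewrite big_ord_recr /= IHm; lia.
Qed.

Lemma restricted_sum_surj (F : finFieldType) (X : {set F}) m (r : F) :
  prime #|F| -> (#|F|.-1 <= m * (#|X| - m))%N ->
  exists Y : {set F}, [/\ Y \subset X, #|Y| = m & \sum_(y in Y) y = r].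
Proof.
move=> pr_F le_m; set p := #|F| in pr_F le_m.
have p_gt1 := prime_gt1 pr_F.
have pcharF : p \in [pchar F] by apply: (@card_finPcharP _ _ 1).
have [/existsP[Y /and3P[sYX /eqP cY /eqP sY]]|/existsPn noY] :=
  boolP [exists Y : {set F},
    [&& Y \subset X, #|Y| == m & \sum_(y in Y) y == r]]; first by exists Y.
exfalso.
pose N := #|X|; pose e (j : 'I_N) : F := enum_val j.
have e_inj : injective e by apply: enum_val_inj.
have N_le : (N <= p)%N by apply: max_card.
pose quo := (p.-1 %/ m)%N; pose rem := (p.-1 %% m)%N.
have def_p : p.-1 = (quo * m + rem)%N by apply: divn_eq.
have m_gt0 : (0 < m)%N by nia.
have rem_lt : (rem < m)%N by apply: ltn_pmod.
(* Distinct exponents of total degree [deg V + (p - 1)]: the staircase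
   [0, 1, ..., m - 1] with [p - 1] boxes added as evenly as possible. *)
pose c (i : 'I_m) : nat := (i + quo + (m - rem <= i))%N.
(* The largest exponent is [m - 1] plus [(p - 1) / m] rounded up; [le_m] keeps it below [N]. *)
have c_lt i : (c i < N)%N.
  have := ltn_ord i; rewrite /c /N; case: leqP => ? ?; nia.
have sum_c : (\sum_i c i = \sum_(i < m) i + p.-1)%N.
  rewrite /c !big_split /= sum_ord_geq sum_nat_const card_ord def_p; lia.
have c_inj (i j : 'I_m) : (i < j)%N -> (c i < c j)%N.
  by rewrite /c; case: leqP; case: leqP; lia.
have [w0 w0P] := dual_weights e_inj.
pose w i := w0 (Ordinal (c_lt i)).
have w_dual i (t : nat) : (t < N)%N -> \sum_j w i j * e j ^+ t = (t == c i)%:R.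
  exact: w0P.
(* By Fermat's little theorem [P] vanishes everywhere except at [r]. *)
pose P : {poly F} := ('X - r%:P) ^+ p.-1 - 1.
have szX : size (('X - r%:P) ^+ p.-1) = p by rewrite size_exp_XsubC; lia.
have szP : size P = p by rewrite size_polyDl ?szX // size_polyN size_poly1.
have leadP : P`_p.-1 = 1.
  have := lead_coefE (('X - r%:P) ^+ p.-1).
  rewrite szX lead_coef_exp lead_coefXsubC expr1n coefB coef1 => <-.
  by rewrite (_ : p.-1 == 0 = false)%N ?subr0 //; lia.
pose sgn (s : 'S_m) : F := (-1) ^+ s.
pose n (s : 'S_m) : {ffun 'I_m -> nat} := [ffun i => s i : nat].
pose f (phi : {ffun 'I_m -> 'I_N}) : F :=
  \det (\matrix_(i < m, j < m) e (phi i) ^+ j) * P.[sum_at e phi].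
(* A repeated index gives two equal rows; otherwise the image of [phi] is an [m]-subset of [X],
   whose sum differs from [r]. *)
have f0 phi : f phi = 0.
  rewrite /f; have [/injectiveP phi_inj|] := boolP (injectiveb phi); last first.
    move=> /injectivePn[i [j neq_ij eq_phi]].
    rewrite (determinant_alternate neq_ij) ?mul0r // => k.
    by rewrite !mxE eq_phi.
  have ephi_inj : injective (e \o phi) by apply: inj_comp.
  pose Y := [set e (phi i) | i in 'I_m].
  have sumY : \sum_(y in Y) y = sum_at e phi.
    by rewrite big_imset //=; apply: in2W; apply: ephi_inj.
  have := noY Y; rewrite card_imset ?card_ord ?eqxx //= sumY.
  have -> : Y \subset X by apply/subsetP => y /imsetP[i _ ->]; apply: enum_valP.
  rewrite /= -subr_eq0 => tot_neq0.
  rewrite /P hornerD horner_exp hornerXsubC hornerN hornerC.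
  rewrite (_ : _ ^+ p.-1 = 1) ?subrr ?mulr0 //.
  apply: (mulfI tot_neq0); rewrite mulr1 -exprS prednK; last by lia.
  exact: expf_card.
have fE phi : f phi =
    \sum_(s : 'S_m) sgn s *
      \sum_(t < p) P`_t * (monom_at e (n s) phi * sum_at e phi ^+ t).
  rewrite /f horner_coef szP mulr_suml; apply: eq_bigr => s _.
  rewrite -mulrA; congr (_ * _); rewrite mulr_sumr; apply: eq_bigr => t _.
  rewrite mulrCA; congr (_ * (_ * _)).
  by apply: eq_bigr => i _; rewrite !mxE ffunE.
(* All terms of the determinant have the same degree, so only the leading term of [P] reaches the
   degree of [x^c]. *)
have sum_n s : (\sum_i n s i = \sum_(i < m) i)%N.
  rewrite [RHS](reindex_inj (@perm_inj _ s)).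
  by apply: eq_bigr => i _; rewrite ffunE.
have : (\prod_i (c i)`!)%:R * dual_eval w f = (p.-1)`!%:R *
    \det (\matrix_(i < m, j < m) (c i ^_ j)%:R) :> F.
  rewrite (_ : dual_eval w f = \sum_(s : 'S_m) sgn s *
      dual_eval w (fun phi => monom_at e (n s) phi * sum_at e phi ^+ p.-1)).
    rewrite !mulr_sumr; apply: eq_bigr => s _.
    rewrite mulrCA (dual_eval_top c_lt w_dual) ?sum_n ?sum_c //.
    rewrite natrM natr_prod mulrCA; congr (_ * (_ * _)).
    by apply: eq_bigr => i _; rewrite mxE ffunE.
  rewrite -dual_eval_sum; under [LHS]eq_bigr do rewrite fE.
  rewrite -/(dual_eval w _) !dual_eval_sum; apply: eq_bigr => s _.
  congr (_ * _); rewrite dual_eval_sum.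
  have lt_p : (p.-1 < p)%N by lia.
  rewrite (bigD1 (Ordinal lt_p)) //= leadP mul1r big1 ?addr0 // => t neq_t.
  rewrite (dual_eval_small c_lt w_dual) ?mulr0 // sum_n sum_c ltn_add2l.
  by move: neq_t (ltn_ord t); rewrite -val_eqE /=; lia.
have -> : dual_eval w f = 0 by apply: big1 => phi _; rewrite f0 mulr0.
(* The exponents are distinct and below [N <= p], so their differences stay nonzero mod [p]. *)
rewrite mulr0 det_ffact => /esym/eqP; apply/negP; rewrite mulf_neq0 //.
  rewrite -(dvdn_pcharf pcharF) prime_ndvd_fact //; lia.
apply/prodf_neq0 => i _; apply/prodf_neq0 => j /c_inj lt_c.
rewrite -natrB 1?ltnW // -(dvdn_pcharf pcharF).
apply/negP => /dvdn_leq; rewrite subn_gt0 lt_c => /(_ isT).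
by have := c_lt j; lia.
Qed.

End RestrictedSums.

(** * Redealing the cards with prescribed sums *)

Lemma modsum_surj d p (X : {set 'I_d}) m (v : 'Z_p) : prime p -> d <= p ->
  p.-1 <= m * (#|X| - m) ->
  exists Y : {set 'I_d}, [/\ Y \subset X, #|Y| = m & modsum p Y = v].
Proof.
move=> pr_p le_dp le_m; have p_gt1 := prime_gt1 pr_p.
(* The field result lives in ['F_p] and the sums in ['Z_p]; congruences of naturals mod [p] link the
   two. *)
pose g (x : 'I_d) : 'F_p := (x : nat)%:R%R.
have eq_Fp k l : (k%:R = l%:R :> 'F_p)%R -> k = l %[mod p].
  by move=> /(congr1 (@nat_of_ord _)); rewrite !val_Fp_nat.
have g_inj : injective g.
  move=> x y /eq_Fp; rewrite !modn_small; first exact: val_inj.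
    exact: leq_trans (ltn_ord y) _.
  exact: leq_trans (ltn_ord x) _.
have [||Y' [sY'X cY' sumY']] :=
  @restricted_sum_surj 'F_p (g @: X) m (v : nat)%:R%R.
- by rewrite card_Fp.
- by rewrite card_Fp // card_imset.
pose Y := X :&: g @^-1: Y'.
have imY : g @: Y = Y'.
  apply/setP => y; apply/imsetP/idP => [[x + ->]|y_in].
    by rewrite !inE => /andP[].
  have /imsetP[x xX def_y] := subsetP sY'X y y_in.
  by exists x; rewrite // !inE xX -def_y.
exists Y; split; first exact: subsetIl.
  by rewrite -cY' -imY card_imset.
have : ((\sum_(x in Y) x)%N%:R = (v : nat)%:R :> 'F_p)%R.
  by rewrite natr_sum -sumY' -imY big_imset //=; apply: in2W.
move=> /eq_Fp eq_mod; rewrite /modsum -natr_sum -[RHS]natr_Zp.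
by rewrite -(Zp_nat_mod p_gt1) eq_mod (Zp_nat_mod p_gt1).
Qed.

Lemma modsumU p d (X Y : {set 'I_d}) : [disjoint X & Y] ->
  modsum p (X :|: Y) = (modsum p X + modsum p Y)%R.
Proof.
move=> disXY; rewrite /modsum -bigU //.
by apply: eq_bigl => x; rewrite !inE.
Qed.

(** The set [B'] is the rest of [A :|: B], so its sum is forced. Withholding [z] leaves
    [#|A| + #|B| - 1] cards to choose from, hence the factor [#|B|.-1]. *)
Lemma redeal_avoiding d p (A B : {set 'I_d}) z : prime p -> d <= p ->
  [disjoint A & B] -> z \in A :|: B -> p.-1 <= #|A| * #|B|.-1 ->
  exists A' B' : {set 'I_d},
    [/\ [disjoint A' & B'], A' :|: B' = A :|: B, #|A'| = #|A|, #|B'| = #|B| &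
      [/\ modsum p A' = modsum p A, modsum p B' = modsum p B & z \notin A']].
Proof.
move=> pr_p le_dp disAB zAB le_p.
have cU : #|A :|: B| = #|A| + #|B|.
  by rewrite cardsU disjoint_setI0 // cards0 subn0.
have cX : #|(A :|: B) :\ z| = (#|A| + #|B|).-1.
  by have := cardsD1 z (A :|: B); rewrite zAB cU => ->.
have B_gt0 : 0 < #|B| by have := prime_gt1 pr_p; nia.
have [|A' [sA'X cA' sumA']] :=
  @modsum_surj d p ((A :|: B) :\ z) #|A| (modsum p A) pr_p le_dp.
  by rewrite cX; apply: leq_trans le_p _; rewrite leq_mul2l; lia.
have sA'U : A' \subset A :|: B := subset_trans sA'X (subsetDl _ _).
have disA'B' : [disjoint A' & (A :|: B) :\: A'].
  by rewrite disjoints_subset setCD subsetUr.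
have UA'B' : A' :|: (A :|: B) :\: A' = A :|: B.
  by rewrite -[RHS](setID _ A') (setIidPr sA'U).
exists A', ((A :|: B) :\: A'); split=> //.
  by rewrite cardsD (setIidPr sA'U) cU cA'; lia.
split=> //; last by apply/negP => /(subsetP sA'X); rewrite !inE eqxx.
by apply: (@addrI _ (modsum p A')); rewrite -modsumU // UA'B' modsumU // sumA'.
Qed.

Theorem mainTheorem7 (a b d p : nat) :
  3 <= a -> 3 <= b -> (a, b) <> (4, 3) -> (a, b) <> (3, 4) ->
  d = a + b + 1 ->
  is_least_prime_geq d p ->
  LPModSum_secure d a b 1 p.
Proof.
move=> a_ge b_ge ne43 ne34 def_d [pr_p le_dp p_min].
have le_p : p + 7 <= d.*2.
  have [d_ge|d_lt] := leqP 9 d.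
    have [q [pr_q le_dq le_q]] := exists_prime_between d_ge.
    by have := p_min q pr_q le_dq; lia.
  (* Below 9 only [d = 7] survives, as [d = 8] would need hands of sizes 3 and 4; then [p = 7]. *)
  have ne : ~~ ((a == 4) && (b == 3)) && ~~ ((a == 3) && (b == 4)).
    by apply/andP; split; apply/negP => /andP[/eqP ea /eqP eb];
      [apply: ne43 | apply: ne34]; rewrite ea eb.
  by have := p_min 7 isT; lia.
(* Here [a (b - 1) - (2d - 8) = (a - 2) (b - 3)], and symmetrically for the other product. *)
have le_ab : p.-1 <= a * b.-1 by nia.
have le_ba : p.-1 <= b * a.-1 by nia.
move=> A B C [[disAB disAC disBC] [cA cB cC]] z zC.
have cAB : #|A :|: B| = a + b.
  by rewrite cardsU disjoint_setI0 // cards0 subn0 cA cB.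
have defAB : A :|: B = ~: C.
  have cC' : #|~: C| = a + b by rewrite cardsCs setCK card_ord cC; lia.
  apply/eqP; rewrite eqEcard cAB cC' leqnn andbT.
  by rewrite subUset -!disjoints_subset disAC.
have deal (A' B' : {set 'I_d}) :
    [disjoint A' & B'] -> A' :|: B' = A :|: B ->
    #|A'| = a -> #|B'| = b -> is_deal a b 1 A' B' C.
  move=> disAB' defAB' cA' cB'; split; split=> //.
    by rewrite disjoints_subset -defAB -defAB' subsetUl.
  by rewrite disjoints_subset -defAB -defAB' subsetUr.
have zAB : z \in A :|: B by rewrite defAB inE.
split.
  have [|A' [B' [dis' U' cA' cB' [sA' sB' zA']]]] :=
    redeal_avoiding pr_p le_dp disAB zAB.
    by rewrite cA cB.
  by exists A', B'; split=> //; split=> //; apply: deal; rewrite ?cA' ?cB'.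
have disBA : [disjoint B & A] by rewrite disjoint_sym.
rewrite setUC in zAB.
have [|B' [A' [dis' U' cB' cA' [sB' sA' zB']]]] :=
  redeal_avoiding pr_p le_dp disBA zAB.
  by rewrite cA cB.
exists A', B'; split=> //; split=> //; apply: deal; rewrite ?cA' ?cB' //.
  by rewrite disjoint_sym.
by rewrite setUC U' setUC.
Qed.
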